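(* For any positive integer $d$, there exists a polynomial $q(k)\in\mathbb{Z}[k]$ with $\deg q(k)=d$ such that, for every positive integer $n$, $$\sum_{k=0}^{n-1} q(k)(-1)^kf_k \equiv 0 \pmod{2n^2}.$$
   Context: The Franel numbers are $f_k=\sum_{i=0}^{k}\binom{k}{i}^3$ for $k\ge 0$. *)

(* Defs.v *)
From mathcomp Require Import all_boot.

Definition franel (k : nat) : nat := \sum_(0 <= i < k.+1) 'C(k, i) ^ 3.

(* Main.v *)
(** Put [a k = (-1)^k f_k]. Franel's three-term recurrence, obtained by creative
    telescoping, says [(k+1)^2 a(k+1) + (7k^2+7k+2) a(k) - 8k^2 a(k-1) = 0].
    Multiplying it by [x(k)] for an arbitrary integer polynomial [x] and summing
    by parts over [k < n] leaves
    [\sum_(k < n) p(k) a(k) = - n^2 (x(n-1) a(n) + 8 x(n) a(n-1))] with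
    [p(k) = k^2 x(k-1) + (7k^2+7k+2) x(k) - 8(k+1)^2 x(k+1)]; the right-hand side
    is divisible by [2n^2] because [f_n] is even for [n > 0]. For [x = X^m] the
    coefficient of [X^(m+2)] in [p] cancels and that of [X^(m+1)] is [-9(m+1)],
    so [p] has degree [m+1]. *)
Require Import Defs.
From mathcomp Require Import all_boot all_order all_algebra.
From mathcomp Require Import ring.
Import GRing.Theory Num.Theory.
Local Open Scope ring_scope.

(** The added binomials vanish. This puts Franel numbers of different indices on one common range,
    so that their recurrence can be checked term by term. *)
Lemma franel_widen (n N : nat) : (n < N)%N ->
  (franel n)%:Z = \sum_(0 <= i < N) ('C(n, i))%:Z ^+ 3.
Proof.
move=> ltnN; rewrite (big_cat_nat (leq0n n.+1) ltnN) /=.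
rewrite [X in _ + X]big_nat_cond [X in _ + X]big1 ?addr0.
  rewrite /franel -natz natr_sum; apply: eq_bigr => i _.
  by rewrite natrX natz.
by move=> i /andP[/andP[ltni _] _]; rewrite bin_small // expr0n.
Qed.

(* The certificate: the unique cubic [T] in [k] satisfying [franel_telescope]. *)
Definition franel_cert (n k : int) : int :=
  4 * k ^+ 3 - (18 * n + 12) * k ^+ 2 + (27 * n ^+ 2 + 39 * n + 12) * k
  - (14 * n ^+ 3 + 32 * n ^+ 2 + 22 * n + 4).

Lemma mulz_bin_down (n k : nat) :
  (n%:Z + 1) * ('C(n, k))%:Z = (n%:Z + 1 - k%:Z) * ('C(n.+1, k))%:Z.
Proof.
have [lekn | ltnk] := leqP k n.+1; last first.
  by rewrite !bin_small ?mulr0 // ltnW.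
have := mul_bin_down n.+1 k; rewrite /= => /(congr1 Posz).
by rewrite !PoszM -subzn // -addn1 PoszD.
Qed.

Lemma mulz_bin_left (n k : nat) :
  (k%:Z + 1) * ('C(n, k.+1))%:Z = (n%:Z - k%:Z) * ('C(n, k))%:Z.
Proof.
have [lekn | ltnk] := leqP k n; last first.
  by rewrite !bin_small ?mulr0 // ltnW.
have := mul_bin_left n k => /(congr1 Posz).
by rewrite !PoszM -subzn // -addn1 PoszD.
Qed.

Lemma franel_telescope (m k : nat) (n : int := m.+1%:Z)
    (G := fun i : nat => franel_cert n i%:Z * (i%:Z * ('C(m.+2, i))%:Z) ^+ 3) :
  n * (n + 1) ^+ 3 *
    ((n + 1) ^+ 2 * ('C(m.+2, k))%:Z ^+ 3
     - (7 * n ^+ 2 + 7 * n + 2) * ('C(m.+1, k))%:Z ^+ 3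
     - 8 * n ^+ 2 * ('C(m, k))%:Z ^+ 3) = G k.+1 - G k.
Proof.
have eB := mulz_bin_down m.+1 k.
have eA := mulz_bin_down m k.
have eC := mulz_bin_left m.+2 k.
have nE : m%:Z + 1 = n by rewrite /n -addn1 PoszD.
have nE' : m.+2%:Z = n + 1 by rewrite /n -[m.+2]addn1 PoszD.
have kE : k.+1%:Z = k%:Z + 1 by rewrite -addn1 PoszD.
rewrite -/n in eB; rewrite nE in eA; rewrite nE' in eC.
rewrite /G kE eC /franel_cert.
move: eA eB {eC}; move: (Posz 'C(m, k)) (Posz 'C(m.+1, k)) (Posz 'C(m.+2, k)).
move=> A B c eA eB.
have eAc : n * (n + 1) * A = (n - k%:Z) * (n + 1 - k%:Z) * c.
  transitivity ((n - k%:Z) * ((n + 1) * B)); last by rewrite eB; ring.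
  by rewrite mulrCA -eA; ring.
(* The factor [n * (n + 1) ^+ 3] lets [A] and [B] enter only through [n * (n + 1) * A] and
   [(n + 1) * B], both polynomial multiples of [c]; a polynomial identity in [n], [k], [c]
   remains. *)
transitivity (n * (n + 1) ^+ 5 * c ^+ 3
    - (7 * n ^+ 2 + 7 * n + 2) * n * ((n + 1) * B) ^+ 3
    - 8 * (n * (n + 1) * A) ^+ 3); first by ring.
rewrite eB eAc; ring.
Qed.

Lemma franel_rec (m : nat) (n : int := m.+1%:Z) :
  (n + 1) ^+ 2 * (franel m.+2)%:Z
  = (7 * n ^+ 2 + 7 * n + 2) * (franel m.+1)%:Z + 8 * n ^+ 2 * (franel m)%:Z.
Proof.
have nE' : n + 1 = m.+2%:Z by rewrite /n -[m.+2]addn1 PoszD.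
have n0 : n * (n + 1) ^+ 3 != 0 by rewrite mulf_neq0 // nE' expf_neq0.
apply/eqP; rewrite -subr_eq0 -(inj_eq (mulfI n0)) mulr0 opprD addrA.
rewrite !(@franel_widen _ m.+3) ?ltnS ?leqnSn ?leqW // !mulr_sumr -!sumrB mulr_sumr.
rewrite (telescope_sumr_eq _ _ (leq0n _) (fun k _ => franel_telescope m k)).
(* Both boundary terms vanish: the upper one through ['C(m.+2, m.+3)], the lower one through the
   factor [i%:Z ^+ 3] at 0. *)
by rewrite bin_small // mul0r mulr0 !expr0n !mulr0 subrr.
Qed.

(** Cubing preserves parity, so the sum has the parity of the row sum [2 ^ n.+1]. *)
Lemma franel_even (n : nat) : ~~ odd (franel n.+1).
Proof.
have -> : odd (franel n.+1) = odd (\sum_(i < n.+2) 'C(n.+1, i)).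
  rewrite /franel big_mkord !(big_morph odd oddD (erefl _)).
  by apply: eq_bigr => i _; rewrite oddX.
have := expnDn 1 1 n.+1.
under eq_bigr do rewrite !exp1n !muln1.
by move=> <-; rewrite oddX.
Qed.

Definition franel_sgn (k : nat) : int := (-1) ^+ k * (franel k)%:Z.

Lemma franel_sgn_even (n : nat) : (2 %| franel_sgn n.+1)%Z.
Proof. by apply: dvdz_mull; rewrite dvdzE /= dvdn2 franel_even. Qed.

Lemma franel_sgn_rec (m : nat) (n : int := m.+1%:Z) :
  (n + 1) ^+ 2 * franel_sgn m.+2
  = 8 * n ^+ 2 * franel_sgn m - (7 * n ^+ 2 + 7 * n + 2) * franel_sgn m.+1.
Proof.
have := franel_rec m; rewrite -/n /franel_sgn !exprS => e.
rewrite mulrCA e; ring.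
Qed.

Definition franel_adjoint (x : {poly int}) : {poly int} :=
  'X ^+ 2 * (x \Po ('X - 1)) + (7 * 'X ^+ 2 + 7 * 'X + 2) * x
  - 8 * ('X + 1) ^+ 2 * (x \Po ('X + 1)).

Lemma sum_franel_adjoint (x : {poly int}) (n : nat) :
  \sum_(0 <= k < n.+1) (franel_adjoint x).[k%:Z] * franel_sgn k
  = - (n.+1%:Z ^+ 2 * (x.[n%:Z] * franel_sgn n.+1
                       + 8 * x.[n.+1%:Z] * franel_sgn n)).
Proof.
have adjE (k : int) : (franel_adjoint x).[k] =
    k ^+ 2 * x.[k - 1] + (7 * k ^+ 2 + 7 * k + 2) * x.[k]
    - 8 * (k + 1) ^+ 2 * x.[k + 1].
  by rewrite /franel_adjoint !(hornerE, horner_comp).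
have f0 : franel_sgn 0 = 1 by rewrite /franel_sgn /franel unlock.
have f1 : franel_sgn 1 = -2 by rewrite /franel_sgn /franel unlock.
(* At [k = 0] the factor [k ^+ 2] kills the stray value of [x] at -1. *)
elim: n => [|n IHn]; first by rewrite big_nat1 adjE f0 f1 add0r; ring.
rewrite big_nat_recr //= IHn adjE.
have e1 : n.+1%:Z - 1 = n%:Z by rewrite -addn1 PoszD addrK.
have e2 : n.+2%:Z = n.+1%:Z + 1 by rewrite -[n.+2]addn1 PoszD.
have := franel_sgn_rec n; rewrite e1 e2 => rec.
(* Regrouping exposes the left side of [rec]. *)
rewrite [RHS](_ : _ = - (x.[n.+1%:Z] * ((n.+1%:Z + 1) ^+ 2 * franel_sgn n.+2)
  + 8 * (n.+1%:Z + 1) ^+ 2 * x.[n.+1%:Z + 1] * franel_sgn n.+1)); last by ring.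
rewrite rec; ring.
Qed.

(* Multiplied by ['X] so that the second coefficient makes sense for [m = 0]. *)
Lemma expXDC_leading (c : int) (m : nat) : exists2 r : {poly int},
  (size r <= m)%N &
  'X * ('X + c%:P) ^+ m = 'X ^+ m.+1 + (m%:R * c)%:P * 'X ^+ m + r.
Proof.
elim: m => [|m [r sr IHm]].
  by exists 0; rewrite ?size_poly0 // mul0r mul0r !addr0 expr0 mulr1 expr1.
exists ('X * r + c%:P * r + (m%:R * c * c)%:P * 'X ^+ m).
  rewrite (leq_trans (size_polyD _ _)) // geq_max; apply/andP; split.
    rewrite (leq_trans (size_polyD _ _)) // geq_max; apply/andP; split.
      by rewrite (leq_trans (size_polyMleq _ _)) // size_polyX.
    by rewrite mul_polyC (leq_trans (size_scale_leq _ _)) // ltnW.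
  by rewrite mul_polyC (leq_trans (size_scale_leq _ _)) // size_polyXn.
rewrite exprSr mulrA IHm -[m.+1%:R]natr1 !exprS.
ring.
Qed.

Lemma size_franel_adjoint (m : nat) : size (franel_adjoint 'X^m) = m.+2.
Proof.
have [r sr er] := expXDC_leading (-1) m.
have [s ss es] := expXDC_leading 1 m.
(* [u] gathers the part of ['X * franel_adjoint 'X^m] of degree at most [m.+1]. Above it,
   ['X^(m.+3)] has coefficient 1 + 7 - 8 = 0 and ['X^(m.+2)] has -m + 7 - 8(m + 2) = -9(m + 1). *)
set u : {poly int} := 'X ^+ 2 * r - 8 * ('X + 1) ^+ 2 * s
  + (2 - 8 - 16 * m%:R : int)%:P * 'X^(m.+1) - (8 * m%:R : int)%:P * 'X^m.
have eX : 'X * franel_adjoint 'X^m = (- (9 * m.+1%:R) : int)%:P * 'X^(m.+2) + u.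
  rewrite /franel_adjoint !comp_Xn_poly; rewrite polyCN polyC1 in er.
  rewrite polyC1 in es.
  transitivity (('X : {poly int}) ^+ 2 * ('X * ('X - 1) ^+ m)
    + (7 * 'X ^+ 2 + 7 * 'X + 2) * ('X * 'X^m)
    - 8 * ('X + 1) ^+ 2 * ('X * ('X + 1) ^+ m)); first by ring.
  rewrite er es /u -[m.+1%:R]natr1 !exprS.
  ring.
have sD (p q : {poly int}) (k : nat) :
    (size p <= k)%N -> (size q <= k)%N -> (size (p + q)%R <= k)%N.
  by move=> sp sq; rewrite (leq_trans (size_polyD _ _)) // geq_max sp.
have sC (c : int) (k : nat) : (size (c%:P * 'X^k : {poly int})%R <= k.+1)%N.
  by rewrite mul_polyC (leq_trans (size_scale_leq _ _)) // size_polyXn.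
have sM (p q : {poly int}) : (size p <= 3)%N -> (size q <= m)%N ->
    (size (p * q)%R <= m.+2)%N.
  move=> sp sq; rewrite (leq_trans (size_polyMleq _ _)) // -subn1 leq_subLR.
  by rewrite (leq_trans (leq_add sp sq)).
have su : (size u < m.+3)%N.
  rewrite ltnS /u; do 3?[apply: (sD)].
  - by apply: sM; rewrite ?size_polyXn.
  - rewrite size_polyN; apply: sM => //.
    rewrite -[8]/(8%:R) -polyC_natr mul_polyC (leq_trans (size_scale_leq _ _)) //.
    by rewrite -[1]opprK -polyC1 -polyCN size_exp_XsubC.
  - exact: sC.
  - by rewrite size_polyN leqW.
have sX : size ('X * franel_adjoint 'X^m) = m.+3.
  have c0 : (- (9 * m.+1%:R) : int) != 0.
    by rewrite oppr_eq0 mulf_neq0 // pnatr_eq0.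
  by rewrite eX mul_polyC size_polyDl size_scale // size_polyXn.
apply: succn_inj; rewrite -sX mulrC size_mulX //.
by apply/eqP => p0; rewrite p0 mulr0 size_poly0 in sX.
Qed.

Theorem corollary7 (d : nat) (hd : (0 < d)%N) :
  exists q : {poly int}, size q = d.+1 /\
    forall n : nat, (0 < n)%N ->
      (\sum_(0 <= k < n) q.[k%:Z] * (-1) ^+ k * (franel k)%:Z
         = 0 %[mod 2 * n%:Z ^+ 2])%Z.
Proof.
(* [franel_adjoint] raises the degree of a monomial by one. *)
exists (franel_adjoint 'X^(d.-1)); split; first by rewrite size_franel_adjoint prednK.
case=> // n _; under eq_bigr do rewrite -mulrA -/(franel_sgn _).
rewrite sum_franel_adjoint; apply/eqP; rewrite eqz_mod_dvd subr0 rpredN mulrC.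
(* The factor 2 comes from the even [franel_sgn n.+1] in one term and from the 8 in the other. *)
apply: dvdz_mul => //; apply: rpredD; first exact/dvdz_mull/franel_sgn_even.
by rewrite -mulrA; apply: dvdz_mulr.
Qed.
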